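(* Let $G$ be a graph with property $( * )$. The affine map $\psi:\mathbb{R}^{\mathrm{faces}(G)}\to\mathbb{R}^{E(G)}$, $\psi(\mathbf x)=A_G\mathbf x+\chi_{\hat0}$, is an affine isomorphism between the Newton polytope $\mathrm{Newton}(D_G)$ and the perfect matching polytope $PM(G)$, i.e. $\psi$ restricted to $\mathrm{Newton}(D_G)$ is a bijection onto $PM(G)$.
   Context: Property $( * )$: $G$ is a finite connected bipartite plane graph with fixed proper black/white coloring, every edge lying in some perfect matching; $E(G)$ is its edge set and $\mathrm{faces}(G)$ its set of bounded faces. An edge of a bounded face $f$ is black-white if going clockwise around $f$ one meets its black endpoint first, white-black otherwise. Down-flip at $f$: if a perfect matching contains all black-white edges of $f$, replace them with the white-black edges (inverse: up-flip). Perfect matchings with $M\le M'$ iff $M$ is obtained from $M'$ by down-flips form a distributive lattice with minimum $\hat0$. For a saturated chain $\hat0=M_0\lessdot\cdots\lessdot M_\ell=M$ with $M_{i-1},M_i$ related by a flip at $f_i$, $\mathrm{mrk}(M)=y_{f_1}\cdots y_{f_\ell}$ (chain-independent); $D_G=\sum_M\mathrm{mrk}(M)$. The Newton polytope of a polynomial is the convex hull of the exponent vectors of its monomials with nonzero coefficient. $PM(G)$ is the convex hull of the indicator vectors $\chi_M\in\{0,1\}^{E(G)}$ of perfect matchings $M$. For $f\in\mathrm{faces}(G)$, $\mathbf v_f\in\mathbb{R}^{E(G)}$ has entry $1$ at black-white edges of $f$, $-1$ at white-black edges of $f$, and $0$ at edges not on $f$; $A_G$ is the matrix with columns $\mathbf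 v_f$, $f\in\mathrm{faces}(G)$. *)

(* Defs.v *)
From HB Require Import structures.
From mathcomp Require Import all_boot all_order all_fingroup all_algebra.
From mathcomp Require Import boolp classical_sets functions.
From mathcomp Require Import mpoly.

Set Implicit Arguments.
Unset Strict Implicit.
Unset Printing Implicit Defensive.

Import Order.TTheory GRing.Theory Num.Theory.
Local Open Scope ring_scope.

Section Darts.
Variable E : Type.

(* The two darts of an edge e are (e, true), leaving its black endpoint, and
   (e, false), leaving its white endpoint. *)
Definition dart_opp (d : E * bool) : E * bool := (d.1, ~~ d.2).

Lemma dart_oppK : involutive dart_opp.
Proof. by case=> e b; rewrite /dart_opp /= negbK. Qed.

End Darts.

(* Finite connected bipartite plane graphs, as combinatorial maps: a graph
   (parallel edges allowed) with a proper coloring, the counterclockwise cyclic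
   order of the edges around each vertex, planarity as Euler's formula, and the
   choice of the unbounded face.
   A dart followed with a given face on its right is continued, at its end
   vertex, by the counterclockwise successor of the opposite dart; so the faces
   are the orbits of [pbg_rot \o dart_opp], and the orbit of a bounded face is
   its boundary walk in clockwise direction. *)
Record plane_bigraph := PlaneBigraph {
  pbg_vertex : finType;
  pbg_edge : finType;
  pbg_black : {set pbg_vertex};
  pbg_origin : pbg_edge * bool -> pbg_vertex;
  pbg_proper : forall d, (pbg_origin d \in pbg_black) = d.2;
  pbg_connected : forall u v,
    connect (fun x y => [exists d, (pbg_origin d == x) &&
                                   (pbg_origin (dart_opp d) == y)]) u v;
  pbg_rot : {perm (pbg_edge * bool)%type};
  pbg_rotP : forall d d',
    (d' \in porbit pbg_rot d) = (pbg_origin d' == pbg_origin d);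
  pbg_next : {perm (pbg_edge * bool)%type} :=
    (perm (inv_inj (@dart_oppK pbg_edge)) * pbg_rot)%g;
  pbg_euler :
    (#|pbg_vertex| + #|porbits pbg_next| = #|pbg_edge| + 2)%N;
  pbg_outer : {set (pbg_edge * bool)%type};
  pbg_outerP : pbg_outer \in porbits pbg_next
}.

Section PerfectMatchings.
Variable G : plane_bigraph.
Local Notation V := (pbg_vertex G).
Local Notation E := (pbg_edge G).

Definition bounded_face : finType :=
  {f : {set (E * bool)%type} | (f \in porbits (pbg_next G)) && (f != pbg_outer G)}.

Definition bw_edges (f : bounded_face) : {set E} :=
  [set e | (e, true) \in val f].

Definition wb_edges (f : bounded_face) : {set E} :=
  [set e | (e, false) \in val f].

Definition incident (e : E) (v : V) : bool :=
  [exists b, pbg_origin (e, b) == v].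

Definition perfect_matching (M : {set E}) : bool :=
  [forall v, #|[set e in M | incident e v]| == 1%N].

Definition every_edge_matched : Prop :=
  forall e : E, exists2 M, perfect_matching M & e \in M.

(* N is the down-flip of M at f. *)
Definition down_flip (f : bounded_face) (M N : {set E}) : bool :=
  [&& perfect_matching M, bw_edges f \subset M
    & N == (M :\: bw_edges f) :|: wb_edges f].

Definition pm_le (M M' : {set E}) : bool :=
  connect (fun N N' => [exists f, down_flip f N N']) M' M.

Definition pm_lt (M M' : {set E}) : bool := (M != M') && pm_le M M'.

Definition pm_covers (M M' : {set E}) : bool :=
  pm_lt M M' && ~~ [exists N, pm_lt M N && pm_lt N M'].

Definition pm_minimum (M : {set E}) : bool :=
  perfect_matching M &&
  [forall M', perfect_matching M' ==> pm_le M M'].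

(* The default value is irrelevant when every edge lies in a perfect matching,
   since the minimum then exists; likewise for [mrk]. *)
Definition hat0 : {set E} := odflt finset.set0 [pick M | pm_minimum M].

Inductive saturated_chain : {set E} -> seq bounded_face -> {set E} -> Prop :=
| sat_chain_nil M : saturated_chain M [::] M
| sat_chain_cons M N M' f s :
    pm_covers M N -> down_flip f N M -> saturated_chain N s M' ->
    saturated_chain M (f :: s) M'.

(* The variable y_f is 'X_(enum_rank f). *)
Definition mrk (M : {set E}) : {mpoly int[#|bounded_face|]} :=
  \prod_(f <- xget [::] (fun s => saturated_chain hat0 s M)) 'X_(enum_rank f).

Definition dimer_poly : {mpoly int[#|bounded_face|]} :=
  \sum_(M : {set E} | perfect_matching M) mrk M.

End PerfectMatchings.

Section Polytopes.
Variable R : realFieldType.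

Definition conv_hull (n : nat) (S : set 'cV[R]_n) : set 'cV[R]_n :=
  fun x => exists (k : nat) (a : 'I_k -> R) (p : 'I_k -> 'cV[R]_n),
    [/\ forall i, 0 <= a i, \sum_i a i = 1, forall i, S (p i)
      & x = \sum_i a i *: p i].

Definition newton (n : nat) (p : {mpoly int[n]}) : set 'cV[R]_n :=
  conv_hull (fun x => exists2 m : 'X_{1..n}, p@_m != 0 & x = \col_i (m i)%:R).

(* R^E and R^faces are spaces of column vectors, indexed through [enum_val]. *)
Definition chi (G : plane_bigraph) (M : {set pbg_edge G}) :
    'cV[R]_#|pbg_edge G| :=
  \col_i (enum_val i \in M)%:R.

Definition pm_polytope (G : plane_bigraph) : set 'cV[R]_#|pbg_edge G| :=
  conv_hull (fun x => exists2 M, perfect_matching M & x = chi M).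

(* When every edge lies in a perfect matching, no edge has the same face on both
   sides, so the two cases are exclusive. *)
Definition face_vec (G : plane_bigraph) (f : bounded_face G) :
    'cV[R]_#|pbg_edge G| :=
  \col_i (if enum_val i \in bw_edges f then 1
          else if enum_val i \in wb_edges f then -1 else 0).

Definition face_mx (G : plane_bigraph) :
    'M[R]_(#|pbg_edge G|, #|bounded_face G|) :=
  \matrix_(i, j) face_vec (enum_val j) i 0.

Definition psi (G : plane_bigraph) (x : 'cV[R]_#|bounded_face G|) :
    'cV[R]_#|pbg_edge G| :=
  face_mx G *m x + chi (hat0 G).

End Polytopes.

Arguments newton R {n} p _.
Arguments pm_polytope R G _ : clear implicits.
Arguments psi R G x : clear implicits.

(* Main.v *)
(** A real function on the edges whose sum at every vertex vanishes is the
    difference, across each edge, of a height function on the faces that is 0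
    on the outer face: by Euler's formula the face vectors span the right
    dimension.  The height is unique because the dual graph is connected, which
    also makes the face vectors of the bounded faces linearly independent and
    [psi] injective.

    Averaging all perfect matchings gives a positive fractional matching [w].
    Let [H_M] be the height of [chi_M - w].  If [H_M > H_M'] somewhere, then [M]
    has a down-flip, found at a face where [H_M] is maximal among the maxima of
    [H_M - H_M'].  Hence two matchings without down-flips have equal heights and
    coincide, so this unique matching is the minimum.  A flip lowers the sum of
    the heights by exactly 1, so every flip is a covering relation, and [psi]
    sends the exponent of [mrk M] to [chi_M]; both polytopes are the convex
    hulls of these corresponding points. *)

Require Import Defs.
From mathcomp Require Import all_boot all_order all_fingroup all_algebra.
From mathcomp Require Import boolp classical_sets functions.
From mathcomp Require Import mpoly zify lra.

Set Implicit Arguments.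
Unset Strict Implicit.
Unset Printing Implicit Defensive.

Import Order.TTheory GRing.Theory Num.Theory.
Local Open Scope ring_scope.

Section PlaneBigraph.
Variable G : plane_bigraph.
Local Notation V := (pbg_vertex G).
Local Notation E := (pbg_edge G).
Local Notation dart := (E * bool)%type.
Local Notation origin := (@pbg_origin G).
Local Notation next := (pbg_next G).
Local Notation rot := (pbg_rot G).
Local Notation face := (porbit next).

(** * Darts, faces and connectedness *)

Lemma pbg_nextE d : next d = rot (dart_opp d).
Proof. by rewrite permM permE. Qed.

Lemma origin_rot d : origin (rot d) = origin d.
Proof. by apply/eqP; rewrite -pbg_rotP -{1}[rot]expg1 mem_porbit. Qed.

Lemma face_rot_opp d : face (rot d) = face (dart_opp d).
Proof.
rewrite -[d in rot d]dart_oppK -pbg_nextE; apply/eqP.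
by rewrite eq_porbit_mem -{1}[next]expg1 mem_porbit.
Qed.

Lemma mem_faceE f d : f \in porbits next -> (d \in f) = (face d == f).
Proof. by case/imsetP=> d' _ ->; rewrite eq_porbit_mem. Qed.

Lemma in_faces d : face d \in porbits next.
Proof. exact: imset_f. Qed.

(** Invariance under [rot] makes [g] a function of the origin, and invariance under [dart_opp]
    carries its value along paths. *)
Lemma dart_const (T : Type) (g : dart -> T) :
  (forall d, g (rot d) = g d) -> (forall d, g (dart_opp d) = g d) ->
  forall d d', g d = g d'.
Proof.
move=> grot gopp.
have gorig d d' : origin d = origin d' -> g d = g d'.
  move/eqP; rewrite -pbg_rotP => /porbitP[i ->].
  by elim: i => [|i IH]; rewrite ?expg0 ?perm1 // expgSr permM grot.
move=> d d'; have /connectP[p] := @pbg_connected G (origin d) (origin d').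
elim: p d => [|y p IH] d /=; first by move=> _ /esym; apply: gorig.
case/andP=> /existsP[d0 /andP[/eqP o1 /eqP o2]] pp lp.
by rewrite (gorig d d0) // -gopp; apply: IH; rewrite o2.
Qed.

Lemma vertex_const (T : Type) (g : V -> T) :
  (forall d, g (origin (dart_opp d)) = g (origin d)) -> forall u v, g u = g v.
Proof.
move=> gopp u v; have /connectP[p] := @pbg_connected G u v.
elim: p u => [|y p IH] u /=; first by move=> _ ->.
case/andP=> /existsP[d0 /andP[/eqP <- /eqP o2]] pp lp.
by rewrite -gopp o2; apply: IH.
Qed.

(** This is connectedness of the dual graph: [rot d] and [dart_opp d] share a face, so [dart_const]
    applies to [H \o face]. *)
Lemma face_const (T : Type) (H : {set dart} -> T) :
  (forall e, H (face (e, true)) = H (face (e, false))) ->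
  forall f g, f \in porbits next -> g \in porbits next -> H f = H g.
Proof.
move=> He f g /imsetP[d _ ->] /imsetP[d' _ ->].
have Hopp x : H (face (dart_opp x)) = H (face x).
  by case: x => e []; rewrite /dart_opp /= He.
by apply: (@dart_const _ (H \o face)) => x /=; rewrite ?face_rot_opp.
Qed.

Lemma incidentE e v : incident e v = (origin (e, v \in pbg_black G) == v).
Proof.
apply/existsP/idP=> [[b /eqP <-]|h]; first by rewrite pbg_proper.
by exists (v \in pbg_black G).
Qed.

Lemma incident_origin d : incident d.1 (origin d).
Proof. by rewrite incidentE pbg_proper -surjective_pairing. Qed.

(** * Circulations and face flows *)

Lemma sum_incident_edges (A : nmodType) (F : E -> A) v :
  \sum_(e | incident e v) F e = \sum_(d | origin d == v) F d.1.
Proof.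
rewrite [RHS](reindex_onto (fun e => (e, v \in pbg_black G)) fst) /=.
  by apply: eq_bigl => e; rewrite incidentE eqxx andbT.
by case=> e b /eqP <-; rewrite pbg_proper.
Qed.

Lemma sum_incident_vertices (A : nmodType) (F : V -> A) e :
  \sum_(v | incident e v) F v = F (origin (e, true)) + F (origin (e, false)).
Proof.
have inc b : incident e (origin (e, b)) := incident_origin (e, b).
have neq : origin (e, true) != origin (e, false).
  by apply/eqP=> /(congr1 (fun v => v \in pbg_black G)); rewrite !pbg_proper.
rewrite (bigD1 (origin (e, true))) //= (bigD1 (origin (e, false))) /=; last first.
  by rewrite inc eq_sym.
rewrite big1 ?addr0 // => v /andP[/andP[/existsP[[] /eqP <-]]];
  by rewrite eqxx.
Qed.

Definition circulation (R : nmodType) (c : E -> R) :=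
  forall v, \sum_(e | incident e v) c e = 0.

Definition face_flow (R : pzRingType) (f : {set dart}) (e : E) : R :=
  ((e, true) \in f)%:R - ((e, false) \in f)%:R.

(** Each visit of the boundary walk to [v] enters by some [dart_opp d] and leaves by [rot d]; up to
    the sign given by the color of [v], these contributions cancel. *)
Lemma circulation_face_flow (R : pzRingType) f :
  f \in porbits next -> circulation (face_flow R f).
Proof.
move=> fF v; rewrite sum_incident_edges.
transitivity ((-1) ^+ (v \notin pbg_black G) *
  (\sum_(d | origin d == v) (d \in f)%:R
   - \sum_(d | origin d == v) (dart_opp d \in f)%:R : R)).
  rewrite -sumrB mulr_sumr; apply: eq_bigr => -[e b] /eqP <-.
  rewrite pbg_proper /face_flow /dart_opp /=.
  by case: b; rewrite /= ?expr0 ?expr1 ?mul1r ?mulN1r ?opprB.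
rewrite [X in X - _](reindex_inj (@perm_inj _ rot)) /=.
under eq_bigl do rewrite origin_rot.
rewrite -sumrB big1 ?mulr0 // => d _.
by rewrite !mem_faceE // face_rot_opp subrr.
Qed.

(** * Ranks of the face and incidence matrices *)

Definition face_matrix : 'M[rat]_(#|porbits next|, #|E|) :=
  \matrix_(i, j) face_flow rat (enum_val i) (enum_val j).

Definition incidence_matrix : 'M[rat]_(#|E|, #|V|) :=
  \matrix_(i, j) (incident (enum_val i) (enum_val j))%:R.

Lemma sum_enum_val (A : nmodType) (T : finType) (F : T -> A) :
  \sum_(i < #|T|) F (enum_val i) = \sum_x F x.
Proof. by rewrite [RHS](big_enum_val (A := T)). Qed.

Lemma sum_face_flow (x : 'rV[rat]_#|porbits next|) e :
  \sum_i x 0 i * face_flow rat (enum_val i) e =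
  \sum_i x 0 i *+ (face (e, true) == enum_val i)
  - \sum_i x 0 i *+ (face (e, false) == enum_val i).
Proof.
rewrite -sumrB; apply: eq_bigr => i _.
by rewrite /face_flow !mem_faceE ?enum_valP // mulrBr !mulr_natr.
Qed.

(** A left kernel vector, read as a function [H] on faces, does not jump across any edge, so it is
    constant. *)
Lemma rank_face_matrix : (#|porbits next| <= (\rank face_matrix).+1)%N.
Proof.
suff: (\rank (kermx face_matrix) <= 1)%N by rewrite mxrank_ker leq_subLR addn1.
apply: leq_trans (mxrankS _) (rank_leq_row (const_mx 1 : 'rV_#|porbits next|)).
apply/rV_subP => x /sub_kermxP xA0.
pose H g := \sum_i x 0 i *+ (g == enum_val i).
have HE i : H (enum_val i) = x 0 i.
  rewrite /H (bigD1 i) //= eqxx mulr1n big1 ?addr0 // => j /negPf ji.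
  by rewrite (inj_eq enum_val_inj) eq_sym ji.
have Hc : forall e, H (face (e, true)) = H (face (e, false)).
  move=> e; apply/eqP; rewrite -subr_eq0 -sum_face_flow.
  move/matrixP/(_ 0 (enum_rank e)): xA0; rewrite !mxE => xA0.
  by apply/eqP; rewrite -[RHS]xA0; apply: eq_bigr => i _; rewrite mxE enum_rankK.
apply/sub_rVP; exists (H (pbg_outer G)); apply/rowP => i.
rewrite !mxE mulr1 -HE; apply: face_const => //; last exact: pbg_outerP.
exact: enum_valP.
Qed.

(* The right kernel consists of the multiples of the coloring [+1/-1]. *)
Lemma rank_incidence_matrix : (#|V| <= (\rank incidence_matrix).+1)%N.
Proof.
pose sg (v : V) : rat := (-1) ^+ (v \in pbg_black G).
suff: (\rank (kermx incidence_matrix^T) <= 1)%N.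
  by rewrite mxrank_ker mxrank_tr leq_subLR addn1.
have [v0 _|noV] := pickP (predT : pred V); last first.
  apply: leq_trans (rank_leq_row _) _.
  by rewrite (eq_card0 noV).
apply: leq_trans (mxrankS _) (rank_leq_row (\row_i sg (enum_val i))).
apply/rV_subP => x /sub_kermxP xA0.
pose y v := sg v * x 0 (enum_rank v).
have yc : forall u v, y u = y v.
  apply: vertex_const => d.
  move/matrixP/(_ 0 (enum_rank d.1)): xA0; rewrite !mxE.
  rewrite (eq_bigr (fun i => if incident d.1 (enum_val i)
                   then x 0 (enum_rank (enum_val i)) else 0)); last first.
    by move=> i _; rewrite !mxE enum_rankK enum_valK mulr_natr mulrb.
  rewrite (sum_enum_val (fun v => if incident d.1 v then x 0 (enum_rank v) else 0)).
  rewrite -big_mkcond /= (sum_incident_vertices (fun v => x 0 (enum_rank v))).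
  rewrite /y /sg !pbg_proper; case: d => e [] /=; rewrite ?expr0 ?expr1; lra.
apply/sub_rVP; exists (y v0); apply/rowP => i.
rewrite !mxE (yc v0 (enum_val i)) /y enum_valK mulrAC /sg -expr2 sqrr_sign.
by rewrite mul1r.
Qed.

(** * Heights of circulations *)

Definition is_height (c : E -> rat) (H : {set dart} -> rat) : Prop :=
  H (pbg_outer G) = 0 /\
  forall e, H (face (e, true)) - H (face (e, false)) = c e.

Lemma height_unique c c' H H' : is_height c H -> is_height c' H' -> c =1 c' ->
  {in porbits next, H =1 H'}.
Proof.
move=> [H0 He] [H0' He'] cc' f fF.
suff: H f - H' f = H (pbg_outer G) - H' (pbg_outer G) by rewrite H0 H0'; lra.
apply: (@face_const _ (fun f => H f - H' f)) => //; last exact: pbg_outerP.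
by move=> e; have := cc' e; rewrite -He -He'; lra.
Qed.

Lemma height_sub_face c H f : f \in porbits next -> f != pbg_outer G ->
  is_height c H ->
  is_height (fun e => c e - face_flow rat f e) (fun g => H g - (g == f)%:R).
Proof.
move=> fF /negPf fo [H0 He]; split=> [|e]; first by rewrite eq_sym fo H0 subrr.
by rewrite -He /face_flow !mem_faceE //; lra.
Qed.

(* By Euler's formula the inclusion of the span of the face flows in the space
   of circulations is an equality of dimensions. *)
Lemma circulation_height (c : E -> rat) :
  circulation c -> exists H, is_height c H.
Proof.
have circ_ker (b : E -> rat) : circulation b ->
    (\row_j b (enum_val j)) *m incidence_matrix = 0.
  move=> cb; apply/rowP => i; rewrite !mxE -[RHS](cb (enum_val i)).
  rewrite [RHS]big_mkcond -[RHS]sum_enum_val; apply: eq_bigr => j _; rewrite !mxE.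
  by case: incident; rewrite ?mulr1 ?mulr0.
have sub : (face_matrix <= kermx incidence_matrix)%MS.
  apply/row_subP => i; apply/sub_kermxP.
  rewrite -[RHS](circ_ker _ (circulation_face_flow rat (enum_valP i))).
  by congr (_ *m _); apply/rowP => j; rewrite !mxE.
have sub' : (kermx incidence_matrix <= face_matrix)%MS.
  rewrite -(geq_leqif (mxrank_leqif_sup sub)) mxrank_ker.
  have := rank_face_matrix; have := rank_incidence_matrix.
  have := pbg_euler G; set F := #|_|; lia.
move=> /circ_ker/sub_kermxP/submx_trans/(_ sub')/submxP[x xE].
pose H g := \sum_i x 0 i *+ (g == enum_val i).
exists (fun g => H g - H (pbg_outer G)); split=> [|e]; first exact: subrr.
transitivity (H (face (e, true)) - H (face (e, false))); first lra.
rewrite -sum_face_flow.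
move/matrixP/(_ 0 (enum_rank e)): xE; rewrite !mxE enum_rankK => ->.
by apply: eq_bigr => i _; rewrite mxE enum_rankK.
Qed.

(** * Indicator vectors of perfect matchings *)

Lemma perfect_matchingP (M : {set E}) :
  reflect (forall v, \sum_(e | incident e v) (e \in M)%:R = 1 :> rat)
          (perfect_matching M).
Proof.
have cE v : #|[set e in M | incident e v]|%:R
    = \sum_(e | incident e v) (e \in M)%:R :> rat.
  rewrite -sum1_card natr_sum big_mkcond [RHS]big_mkcond.
  by apply: eq_bigr => e _; rewrite inE andbC; case: incident => //; case: (e \in M).
apply: (iffP forallP) => h v; have := h v; rewrite -cE; first by move/eqP ->.
by move/eqP; rewrite pnatr_eq1.
Qed.

Lemma perfect_matching_unique (M : {set E}) v e e' : perfect_matching M ->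
  e \in M -> e' \in M -> incident e v -> incident e' v -> e = e'.
Proof.
move=> /forallP/(_ v)/cards1P[x Mx] eM eM' iev iev'.
have: e \in [set x] by rewrite -Mx inE eM.
have: e' \in [set x] by rewrite -Mx inE eM'.
by rewrite !inE => /eqP -> /eqP ->.
Qed.

Lemma circulation_matchings (M M' : {set E}) :
  perfect_matching M -> perfect_matching M' ->
  circulation (fun e => (e \in M)%:R - (e \in M')%:R : rat).
Proof.
by move=> /perfect_matchingP h /perfect_matchingP h' v; rewrite sumrB h h' subrr.
Qed.

Lemma val_bounded_face (f : bounded_face G) :
  val f \in porbits next /\ val f != pbg_outer G.
Proof. by apply/andP; exact: valP f. Qed.

(** * Face boundaries and down-flips *)

Section EveryEdgeMatched.
Hypothesis hG : every_edge_matched G.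

(* An edge with [f] on both sides has height difference 0 for any two perfect
   matchings, hence lies in all of them; then it is a connected component of
   [G], and [f] is the only face. *)
Lemma bounded_face_simple (f : bounded_face G) e :
  (e, true) \in val f -> (e, false) \notin val f.
Proof.
have [fF fo] := val_bounded_face f.
move=> et; apply: contra fo => ef.
have eall (M : {set E}) : perfect_matching M -> e \in M.
  move=> pM; have [M' pM' eM'] := hG e.
  have [H [_ /(_ e)]] := circulation_height (circulation_matchings pM' pM).
  move: et ef; rewrite !mem_faceE // => /eqP -> /eqP ->.
  by rewrite subrr eM'; case: (e \in M) => //=; rewrite subr0 => /esym/eqP.
have eonly e' b b' : origin (e', b') = origin (e, b) -> e' = e.
  move=> oe; have [M pM e'M] := hG e'.
  apply: (perfect_matching_unique (v := origin (e, b)) pM) => //; first exact: eall.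
    by rewrite -oe (incident_origin (e', b')).
  exact: (incident_origin (e, b)).
have [d _ oE] := imsetP (pbg_outerP G).
suff ed : d.1 = e.
  apply/eqP; apply: etrans (esym oE); apply/esym/eqP; rewrite -mem_faceE //.
  by case: d ed {oE} => e' [] /= ->.
have /connectP[p] := @pbg_connected G (origin (e, true)) (origin d).
elim: p true => [|y p IH] b /=.
  by case: d {oE} => e' b' _ /eonly.
case/andP=> /existsP[[e' b'] /andP[/eqP o1 /eqP <-]].
by rewrite /dart_opp /= (eonly _ _ _ o1); apply: IH.
Qed.

(** After [(e, false)] the walk around [f] takes [rot (e, true)], a black-white edge at the same
    black vertex. It lies in [M], so a matched [e] would equal it and have [f] on both sides. *)
Lemma wb_edges_unmatched (f : bounded_face G) (M : {set E}) e :
  perfect_matching M -> bw_edges f \subset M -> e \in wb_edges f -> e \notin M.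
Proof.
move=> pM /fintype.subsetP sM; rewrite inE => ef; apply/negP => eM.
have [fF _] := val_bounded_face f.
suff /bounded_face_simple : (e, true) \in val f by rewrite ef.
have := origin_rot (e, true); case rE: (rot (e, true)) => [e' b'] oE.
have b't : b' = true.
  by have := congr1 (fun v => v \in pbg_black G) oE; rewrite !pbg_proper.
have e'f : (e', true) \in val f.
  by rewrite -b't -rE mem_faceE // face_rot_opp -mem_faceE.
have e'M : e' \in M by apply: sM; rewrite inE.
suff -> : e = e' by [].
apply: (perfect_matching_unique (v := origin (e, true)) pM) => //.
  exact: (incident_origin (e, true)).
by rewrite -oE (incident_origin (e', b')).
Qed.

Lemma face_flowE (R : pzRingType) (f : bounded_face G) e :
  face_flow R (val f) e = if e \in bw_edges f then 1
                          else if e \in wb_edges f then -1 else 0.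
Proof.
rewrite /face_flow !inE; have := @bounded_face_simple f e.
case: ((e, true) \in val f) => [/(_ isT)/negPf -> |_]; first by rewrite subr0.
by case: ((e, false) \in val f); rewrite ?subrr ?sub0r.
Qed.

Lemma down_flip_indicator (R : pzRingType) f (M N : {set E}) e :
  down_flip f M N ->
  (e \in N)%:R = (e \in M)%:R - face_flow R (val f) e :> R.
Proof.
case/and3P=> pM sM /eqP ->; rewrite face_flowE !inE.
have := wb_edges_unmatched (e := e) pM sM.
have := fintype.subsetP sM e; rewrite !inE.
have := @bounded_face_simple f e.
case: ((e, true) \in val f) => [/(_ isT)/negPf -> /(_ isT) -> _|_ _] /=.
  by rewrite subrr.
case: ((e, false) \in val f) => [/(_ isT)/negPf -> |_] /=.
  by rewrite sub0r opprK.
by rewrite orbF subr0.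
Qed.

Lemma down_flip_perfect f (M N : {set E}) :
  down_flip f M N -> perfect_matching N.
Proof.
move=> fl; apply/perfect_matchingP => v.
under eq_bigr do rewrite (down_flip_indicator _ _ fl).
have [fF _] := val_bounded_face f; have /and3P[pM _ _] := fl.
rewrite sumrB (circulation_face_flow rat fF) subr0.
by apply/perfect_matchingP.
Qed.

(** * Heights of perfect matchings *)

Lemma interior_fractional_matching : exists w : E -> rat,
  (forall e, 0 < w e) /\ forall v, \sum_(e | incident e v) w e = 1.
Proof.
pose n := #|[set M : {set E} | perfect_matching M]|.
exists (fun e => n%:R^-1 * \sum_(M : {set E} | perfect_matching M) (e \in M)%:R).
have n0 : (0 < n)%N.
  have [d _ _] := imsetP (pbg_outerP G); have [M pM _] := hG d.1.
  by apply/card_gt0P; exists M; rewrite inE.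
split=> [e|v].
  have [M pM eM] := hG e.
  rewrite mulr_gt0 ?invr_gt0 ?ltr0n // (bigD1 M) //= eM.
  by rewrite ltr_pwDl ?ltr01 // sumr_ge0 // => *; rewrite ler0n.
rewrite -mulr_sumr exchange_big /= (eq_bigr (fun=> 1)); last first.
  by move=> M /perfect_matchingP/(_ v).
rewrite (eq_bigl (fun M => M \in [set M : {set E} | perfect_matching M])).
  by rewrite sumr_const mulVf // pnatr_eq0 -lt0n.
by move=> M; rewrite inE.
Qed.

(* Among the faces maximizing [H - H'], take one maximizing [H]: an unmatched
   black-white edge would lead to a neighbor that is better for [H] and not
   worse for [H - H']. *)
Lemma down_flippable (w : E -> rat) (M M' : {set E}) H H' f0 :
  (forall e, 0 < w e) ->
  is_height (fun e => (e \in M)%:R - w e) H ->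
  is_height (fun e => (e \in M')%:R - w e) H' ->
  f0 \in porbits next -> H' f0 < H f0 ->
  exists f : bounded_face G, bw_edges f \subset M.
Proof.
move=> w0 [H0 He] [H0' He'] f0F lt0.
case: (@arg_maxP _ _ _ f0 (fun g => g \in porbits next)
                (fun g => H g - H' g) f0F) => f1 f1F max1.
pose P g := (g \in porbits next) && (H f1 - H' f1 <= H g - H' g).
have Pf1 : P f1 by rewrite /P f1F lexx.
case: (@arg_maxP _ _ _ f1 P H Pf1) => f /andP[fF fmax] max2.
(* The maximum of [H - H'] is positive because of [f0], whereas the difference is 0 on the outer
   face. *)
have fo : f != pbg_outer G.
  apply/eqP => fo; have := max1 _ f0F; move: fmax; rewrite fo H0 H0' /=; lra.
have fB : (f \in porbits next) && (f != pbg_outer G) by rewrite fF.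
exists (Sub f fB); apply/fintype.subsetP => e.
rewrite inE SubK mem_faceE // => /eqP fE.
have [//|eM] := boolP (e \in M).
have := He e; have := He' e; rewrite fE (negPf eM) sub0r => h h'.
have we := w0 e; have eM' : 0 <= (e \in M')%:R :> rat by rewrite ler0n.
(* Crossing the unmatched edge raises [H] by [w e] and [H'] by at most [w e]. *)
have : P (face (e, false)) by rewrite /P in_faces /=; lra.
by move/max2 => /=; lra.
Qed.

Lemma exists_heights : exists (w : E -> rat) (H : {set E} -> {set dart} -> rat),
  (forall e, 0 < w e) /\
  forall M, perfect_matching M -> is_height (fun e => (e \in M)%:R - w e) (H M).
Proof.
have [w [w0 w1]] := interior_fractional_matching; exists w.
suff /choice[H HP] : forall M, exists h,
    perfect_matching M -> is_height (fun e => (e \in M)%:R - w e) h.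
  by exists H.
move=> M; have [pM|_] := boolP (perfect_matching M); last by exists (fun=> 0).
have [v|h hP] := @circulation_height (fun e => (e \in M)%:R - w e); last by exists h.
by rewrite sumrB w1 (elimT (perfect_matchingP M) pM) subrr.
Qed.

(** * The flip order and its minimum *)

Section Heights.
Variables (w : E -> rat) (H : {set E} -> {set dart} -> rat).
Hypothesis w_gt0 : forall e, 0 < w e.
Hypothesis HP : forall M,
  perfect_matching M -> is_height (fun e => (e \in M)%:R - w e) (H M).

Definition height_sum (M : {set E}) : rat := \sum_(g in porbits next) H M g.

(** By uniqueness of heights, [H N] is [H M] lowered by 1 at the face [f] alone. *)
Lemma height_sum_flip f (M N : {set E}) : down_flip f M N ->
  height_sum M = height_sum N + 1.
Proof.
move=> fl; have pN := down_flip_perfect fl; have /and3P[pM _ _] := fl.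
have [fF fo] := val_bounded_face f.
have HN : {in porbits next, H N =1 fun g => H M g - (g == val f)%:R}.
  apply: height_unique (HP pN) (height_sub_face fF fo (HP pM)) _ => e.
  by rewrite (down_flip_indicator _ e fl) addrAC.
rewrite /height_sum (eq_bigr _ HN) sumrB -[LHS]addr0 -addrA; congr (_ + _).
rewrite (bigD1 (val f)) //= eqxx big1 ?addr0 ?addNr // => g /andP[_ /negPf ->].
by [].
Qed.

Lemma pm_le_height_sum (M N : {set E}) : pm_le N M -> N != M ->
  height_sum N + 1 <= height_sum M.
Proof.
case/connectP=> p; elim: p M => [|M' p IH] M /=; first by move=> _ ->; rewrite eqxx.
case/andP=> /existsP[f fl] pp lp _; rewrite (height_sum_flip fl).
have [->//|NM'] := eqVneq N M'.
by rewrite lerD2r; apply: le_trans (IH _ pp lp NM'); rewrite lerDl.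
Qed.

(** A set strictly between would force the height sums to differ by at least 2. *)
Lemma down_flip_covers f (M N : {set E}) : down_flip f N M -> pm_covers M N.
Proof.
move=> fl; have hE := height_sum_flip fl.
apply/andP; split.
  apply/andP; split; last by apply: connect1; apply/existsP; exists f.
  by apply/eqP => MN; move: hE; rewrite MN; lra.
apply/existsP => -[N' /andP[/andP[n1 l1] /andP[n2 l2]]].
have := pm_le_height_sum l1 n1; have := pm_le_height_sum l2 n2; lra.
Qed.

Definition unflippable (M : {set E}) :=
  perfect_matching M && ~~ [exists f, bw_edges f \subset M].

Lemma unflippable_unique (M N : {set E}) : unflippable M -> unflippable N -> M = N.
Proof.
move=> /andP[pM /existsP uM] /andP[pN /existsP uN].
have HE g : g \in porbits next -> H M g = H N g.
  move=> gF; have [lt|lt|//] := ltgtP (H M g) (H N g).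
    by case: uN; apply: down_flippable (HP pN) (HP pM) gF lt.
  by case: uM; apply: down_flippable (HP pM) (HP pN) gF lt.
have [_ hM] := HP pM; have [_ hN] := HP pN.
apply/setP => e; have := hM e; rewrite !HE ?in_faces // hN => /addIr.
by do 2!case: (_ \in _) => // /eqP; rewrite ?oner_eq0 // eq_sym oner_eq0.
Qed.

Lemma exists_unflippable_below (M : {set E}) : perfect_matching M ->
  exists2 N, unflippable N & pm_le N M.
Proof.
(* Height sums are rational, so the induction runs on the number of edge sets with a smaller one; a
   down-flip removes at least its result from them. *)
have [k] := ubnP #|[set N | height_sum N < height_sum M]|.
elim: k M => // k IH M leM pM.
have [/existsP[f fM]|uM] := boolP [exists f, bw_edges f \subset M]; last first.
  by exists M; [apply/andP | apply: connect0].
pose M' := (M :\: bw_edges f) :|: wb_edges f.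
have fl : down_flip f M M' by rewrite /down_flip pM fM eqxx.
have hE := height_sum_flip fl.
have [|N uN leN] := IH M' _ (down_flip_perfect fl).
  apply: leq_trans (proper_card _) leM; apply/properP; split.
    by apply/fintype.subsetP => N; rewrite !inE; lra.
  by exists M'; rewrite !inE; lra.
exists N => //; apply: connect_trans leN.
by apply: connect1; apply/existsP; exists f.
Qed.

Lemma hat0_minimum : pm_minimum (hat0 G).
Proof.
rewrite /hat0; case: pickP => //= no_min.
have [d _ _] := imsetP (pbg_outerP G); have [M pM _] := hG d.1.
have [N uN _] := exists_unflippable_below pM.
have := no_min N; rewrite /pm_minimum; have /andP[-> _] := uN.
move/negP; case; apply/forallP => M'; apply/implyP => pM'.
have [N' uN' ?] := exists_unflippable_below pM'.
by rewrite (unflippable_unique uN uN').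
Qed.

(** Paths of down-flips start at the top and chains at the bottom, so an induction along the path
    appends each flip at the end of the chain. *)
Lemma saturated_chain_rcons (M N N' : {set E}) f s : saturated_chain M s N ->
  pm_covers N N' -> down_flip f N' N -> saturated_chain M (rcons s f) N'.
Proof.
move=> ch cv fl; elim: ch cv fl => [M0|M1 N1 M2 g t cv1 fl1 _ IH] cv fl /=.
  exact: sat_chain_cons cv fl (sat_chain_nil _).
exact: sat_chain_cons cv1 fl1 (IH cv fl).
Qed.

Lemma pm_le_saturated_chain (M N : {set E}) :
  pm_le N M -> exists s, saturated_chain N s M.
Proof.
case/connectP=> p; elim: p M => [|M' p IH] M /=.
  by move=> _ ->; exists [::]; apply: sat_chain_nil.
case/andP=> /existsP[f fl] pp lp; have [s ch] := IH _ pp lp.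
by exists (rcons s f); apply: saturated_chain_rcons ch (down_flip_covers fl) fl.
Qed.

End Heights.

(** * Saturated chains and the map [psi] *)

Lemma hat0_saturated_chain (M : {set E}) : perfect_matching M ->
  exists s, saturated_chain (hat0 G) s M.
Proof.
have [w [H [w0 HP]]] := exists_heights.
move=> pM; apply: (pm_le_saturated_chain HP).
by have /andP[_ /forallP/(_ M)/implyP] := hat0_minimum w0 HP; apply.
Qed.

Lemma saturated_chain_indicator (R : pzRingType) (M N : {set E}) s e :
  saturated_chain M s N ->
  (e \in N)%:R = (e \in M)%:R + \sum_(f <- s) face_flow R (val f) e.
Proof.
elim=> [M0|M0 N0 N1 f t _ fl _ ->]; first by rewrite big_nil addr0.
by rewrite big_cons (down_flip_indicator R e fl) addrA subrK.
Qed.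

Lemma face_mxE (R : realFieldType) i j :
  face_mx R G i j = face_flow R (val (enum_val j)) (enum_val i).
Proof. by rewrite !mxE face_flowE. Qed.

Lemma psi_saturated_chain (R : realFieldType) (M : {set E}) s :
  saturated_chain (hat0 G) s M ->
  psi R G (\col_i ((\sum_(f <- s) U_(enum_rank f))%MM i)%:R) = chi R M.
Proof.
move=> ch; apply/colP => i; rewrite [RHS]mxE (saturated_chain_indicator _ _ ch).
rewrite mxE addrC mxE; congr (_ + _); rewrite mxE.
under [LHS]eq_bigr do rewrite face_mxE mxE mnm_sumE natr_sum mulr_sumr.
rewrite exchange_big /=; apply: eq_bigr => f _.
rewrite (bigD1 (enum_rank f)) //= mnm1E eqxx mulr1 enum_rankK big1 ?addr0 //.
by move=> j /negPf; rewrite eq_sym mnm1E => ->; rewrite mulr0.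
Qed.

Lemma psi_inj (R : realFieldType) : injective (psi R G).
Proof.
move=> x y /addIr/eqP; rewrite -subr_eq0 -mulmxBr => /eqP.
move: (x - y) (subr_eq0 x y) => z zE Az0.
apply/eqP; rewrite -zE; apply/eqP/colP => j; rewrite [RHS]mxE.
(* [H] extends the kernel vector [z] by 0 to the outer face. It has no jump across any edge, so it
   is constantly 0 on faces. *)
pose H g := \sum_j (g == val (enum_val j))%:R * z j 0.
have Ho : H (pbg_outer G) = 0.
  rewrite /H big1 // => k _; have [_] := val_bounded_face (enum_val k).
  by rewrite eq_sym => /negPf ->; rewrite mul0r.
have <- : H (val (enum_val j)) = z j 0.
  rewrite /H (bigD1 j) //= eqxx mul1r big1 ?addr0 // => k /negPf kj.
  by rewrite (inj_eq val_inj) (inj_eq enum_val_inj) eq_sym kj mul0r.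
rewrite -Ho; apply: face_const; last exact: pbg_outerP; last first.
  by have [] := val_bounded_face (enum_val j).
move=> e; apply/eqP; rewrite -subr_eq0 -sumrB; apply/eqP.
move/matrixP/(_ (enum_rank e) 0): Az0.
rewrite [X in _ = X -> _]mxE [X in X = _ -> _]mxE => Az0.
rewrite -[RHS]Az0.
apply: eq_bigr => k _; have [kF _] := val_bounded_face (enum_val k).
by rewrite face_mxE enum_rankK /face_flow !mem_faceE // mulrBl.
Qed.

(** * Support of the dimer polynomial *)

Lemma mrk_exponent (M : {set E}) : perfect_matching M ->
  exists2 s, saturated_chain (hat0 G) s M
           & mrk M = 'X_[\sum_(f <- s) U_(enum_rank f)].
Proof.
move=> pM; exists (xget [::] (fun s => saturated_chain (hat0 G) s M)).
  (* Since some chain exists, [xget] selects a genuine one rather than its default. *)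
  exact: (@xgetPex _ [::] (fun s => saturated_chain _ s M)
            (hat0_saturated_chain pM)).
by rewrite /mrk mprodXE.
Qed.

(** Nothing cancels: each [mrk M] is a monomial with coefficient 1, so a coefficient counts
    matchings. *)
Lemma dimer_poly_supportP m :
  (dimer_poly G)@_m != 0 <->
  exists2 M : {set E}, perfect_matching M & mrk M = 'X_[m].
Proof.
have -> : (dimer_poly G)@_m =
    (\sum_(M : {set E} | perfect_matching M) (mrk M == 'X_[m]))%N%:R.
  rewrite /dimer_poly raddf_sum natr_sum; apply: eq_bigr => M.
  case/mrk_exponent=> s _ ->; rewrite /= mcoeffX; congr (nat_of_bool _)%:R.
  apply/eqP/eqP=> [-> //|/(congr1 (mcoeff m))]; rewrite !mcoeffX eqxx.
  by case: eqP.
rewrite pnatr_eq0 sum_nat_eq0 negb_forall; split=> [/existsP[M]|[M pM mM]].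
  by rewrite negb_imply eqb0 negbK => /andP[pM /eqP mM]; exists M.
by apply/existsP; exists M; rewrite pM mM eqxx.
Qed.

End EveryEdgeMatched.
End PlaneBigraph.

(** * Convex hulls under affine maps *)

Section ConvexHull.
Variable R : realFieldType.

Lemma conv_hull_affine n n' (A : 'M[R]_(n', n)) b (S : set 'cV[R]_n)
    (S' : set 'cV[R]_n') :
  (forall x, S x -> S' (A *m x + b)) ->
  forall x, conv_hull S x -> conv_hull S' (A *m x + b).
Proof.
move=> SS' x [k [a [p [a0 a1 Sp ->]]]].
exists k, a, (fun i => A *m p i + b); split=> // [i|]; first exact: SS'.
(* As the weights sum to 1, the translation [b] distributes over the points. *)
rewrite mulmx_sumr -[b in LHS]scale1r -a1 scaler_suml -big_split /=.
by apply: eq_bigr => i _; rewrite scalerDr scalemxAr.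
Qed.

Lemma conv_hull_affine_surj n n' (A : 'M[R]_(n', n)) b (S : set 'cV[R]_n)
    (S' : set 'cV[R]_n') :
  (forall y, S' y -> exists2 x, S x & A *m x + b = y) ->
  forall y, conv_hull S' y -> exists2 x, conv_hull S x & A *m x + b = y.
Proof.
move=> SS' y [k [a [p [a0 a1 Sp ->]]]].
have /choice[q qP] i : exists x, S x /\ A *m x + b = p i.
  by have [x] := SS' _ (Sp i); exists x.
exists (\sum_i a i *: q i).
  by exists k, a, q; split=> // i; have [] := qP i.
rewrite mulmx_sumr -[b in LHS]scale1r -a1 scaler_suml -big_split /=.
by apply: eq_bigr => i _; have [_ <-] := qP i; rewrite scalerDr scalemxAr.
Qed.

End ConvexHull.

Theorem theorem3p6 (R : realFieldType) (G : plane_bigraph)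
    (hG : every_edge_matched G) :
  set_bij (newton R (dimer_poly G)) (pm_polytope R G) (psi R G).
Proof.
split.
- apply: conv_hull_affine => x [m /(dimer_poly_supportP hG)[M pM mM] ->].
  exists M => //; have [s ch sE] := mrk_exponent hG pM.
  rewrite -(psi_saturated_chain hG R ch).
  suff <- : (\sum_(f <- s) U_(enum_rank f))%MM = m by [].
  (* Comparing the coefficients at [m] of two equal monomials identifies their exponents. *)
  move: mM; rewrite sE => /(congr1 (mcoeff m)); rewrite !mcoeffX eqxx.
  by case: eqP.
- by move=> x y _ _; apply: psi_inj.
- apply: conv_hull_affine_surj => y [M pM ->].
  have [s ch sE] := mrk_exponent hG pM.
  exists (\col_i ((\sum_(f <- s) U_(enum_rank f))%MM i)%:R); last first.
    by rewrite -(psi_saturated_chain hG R ch).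
  exists (\sum_(f <- s) U_(enum_rank f))%MM => //.
  have [_] := dimer_poly_supportP hG (\sum_(f <- s) U_(enum_rank f))%MM.
  by apply; exists M.
Qed.
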